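(* Let $X$ be an infinite compact Hausdorff space. Then $X$ is a Dugundji space if and only if there exists an additive $d$-club for $X$.
   Context: All spaces considered as domains are infinite Tychonoff spaces; all maps are continuous; the weight $w(Y)$ of a space is by convention always an infinite cardinal (i.e. $\max$ of $\aleph_0$ and the least cardinality of a base). Dugundji spaces. Maps $f:X\to Y$ and $g:X\to Z$ are homeomorphic if there is a homeomorphism $h:Z\to Y$ with $f=h\circ g$. For maps $\phi,g$ defined on $X$, write $\phi\prec g$ if there is a map $h:\phi[X]\to g[X]$ with $g=h\circ\phi$. Every map in the lattices below, and every diagonal product, is regarded as a map onto its image. A family $\Psi$ of maps with common domain $X$ is a multiplicative lattice if: (L1) for any map $f:X\to f[X]$ there is $\phi\in\Psi$ with $\phi\prec f$ and $w(\phi[X])\le w(f[X])$; (L2) if $\{\phi_\alpha:\alpha\in J\}\subset\Psi$, then the diagonal product $\triangle\{\phi_\alpha:\alpha\in J\}$ is homeomorphic to some element of $\Psi$. Dugundji spaces are taken in their topological description (due to Shchepin): a compact Hausdorff space is a Dugundji space if and only if it has a multiplicative lattice consisting of open maps. Families of co-zero sets. $\operatorname{coZ}(X)$ is the family of all co-zero subsets of $X$; $[\operatorname{coZ}(X)]^{\omega}$ is the collection of all countable infinite families of co-zero sets, and $[\operatorname{coZ}(X)]^{\le\omega}$ the collection of all at most countable ones. For a family $\mathcal A$ of sets, $\langle\mathcal A\rangle$ is the least family containing $\mathcal A$ and closed under finite intersections and finite unions. Property Seq. A family $\mathcal P$ of open sets has the property Seq if for every $W\in\mathcal P$ there are sequences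 $\{U_n:n\ge0\}\subseteq\mathcal P$ and $\{V_n:n\ge0\}\subseteq\mathcal P$ with $U_k\subseteq X\setminus V_k\subseteq U_{k+1}$ for each $k$ and $\bigcup_n U_n=W$. The relation $\subset_!$. For a family $\mathcal P$ of co-zero sets, $\mathcal P\subset_!\operatorname{coZ}(X)$ means that for any $\mathcal S\subset\mathcal P$ and any $x\notin\overline{\bigcup\mathcal S}$ there is $W\in\mathcal P$ with $x\in W$ and $W\cap\bigcup\mathcal S=\varnothing$. Clubs. A collection $\mathcal C\subseteq[\operatorname{coZ}(X)]^{\omega}$ is a club if (i) $\mathcal A_1\subseteq\mathcal A_2\subseteq\dots$ with all $\mathcal A_n\in\mathcal C$ implies $\bigcup_n\mathcal A_n\in\mathcal C$; (ii) for any $\mathcal B\in[\operatorname{coZ}(X)]^{\le\omega}$ there is $\mathcal A\in\mathcal C$ with $\mathcal B\subseteq\mathcal A$. A club $\mathcal C$ is a $d$-club if every $\mathcal P\in\mathcal C$ satisfies $\mathcal P\subset_!\operatorname{coZ}(X)$, has the property Seq, and is closed under finite unions and finite intersections. A $d$-club $\mathcal C$ is additive if $\langle\mathcal A_1\cup\mathcal A_2\rangle\in\mathcal C$ for all $\mathcal A_1,\mathcal A_2\in\mathcal C$. *)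

(* Defs.v *)
From HB Require Import structures.
From mathcomp Require Import all_boot all_order all_algebra.
From mathcomp Require Import all_classical all_reals all_analysis.

Set Implicit Arguments.
Unset Strict Implicit.
Unset Printing Implicit Defensive.

Import GRing.Theory Num.Theory numFieldNormedType.Exports.

Local Open Scope classical_set_scope.
Local Open Scope card_scope.
Local Open Scope ring_scope.

Definition tychonoff_space (T : topologicalType) : Prop :=
  hausdorff_space T /\ completely_regular_space T.

Definition least_basis (T : topologicalType) (B : set (set T)) : Prop :=
  basis B /\ forall B' : set (set T), basis B' -> B #<= B'.

(* [w(Y) <= w(Z)], where [w] is the maximum of aleph_0 and the least cardinality
   of a basis; for cardinals, max(aleph_0, b) <= max(aleph_0, c) if and only if
   b <= aleph_0 or b <= c. *)
Definition weight_le (Y Z : topologicalType) : Prop :=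
  exists (B : set (set Y)) (C : set (set Z)),
    [/\ least_basis B, least_basis C & countable B \/ B #<= C].

(* A map on [X] is identified with the corresponding map onto its image. *)
Record onto_map (X : topologicalType) := OntoMap {
  image_space : topologicalType;
  onto_fun :> X -> image_space;
  onto_tychonoff : tychonoff_space image_space;
  onto_continuous : continuous onto_fun;
  onto_surj : set_surj [set: X] [set: image_space] onto_fun
}.

Definition open_map (X Y : topologicalType) (f : X -> Y) : Prop :=
  forall U : set X, open U -> open (f @` U).

Definition homeomorphism (Y Z : topologicalType) (h : Z -> Y) : Prop :=
  exists k : Y -> Z, [/\ cancel h k, cancel k h, continuous h & continuous k].

Definition homeomorphic_maps (X Y Z : topologicalType)
    (f : X -> Y) (g : X -> Z) : Prop :=
  exists2 h : Z -> Y, homeomorphism h & f = h \o g.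

Definition map_prec (X : topologicalType) (phi g : onto_map X) : Prop :=
  exists2 h : image_space phi -> image_space g,
    continuous h & onto_fun g = h \o phi.

Definition diag_map (X : topologicalType) (J : Type) (phi : J -> onto_map X) :
    X -> prod_topology (fun a => image_space (phi a)) :=
  fun x a => phi a x.

(* The diagonal product as a map onto its image, the latter carrying the
   subspace topology of the product. *)
Definition diagonal_product (X : topologicalType) (J : Type)
    (phi : J -> onto_map X) : X -> set_type (range (diag_map phi)) :=
  fun x => exist _ (diag_map phi x) (mem_set (imageT (diag_map phi) x)).

(* [set (onto_map X)] would be a universe inconsistency, hence the plain
   predicate. *)
Definition multiplicative_lattice (X : topologicalType)
    (Psi : onto_map X -> Prop) : Prop :=
  (forall f : onto_map X, exists phi : onto_map X,
     [/\ Psi phi, map_prec phi f & weight_le (image_space phi) (image_space f)])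
  /\
  (forall (J : Type) (phi : J -> onto_map X), (forall a, Psi (phi a)) ->
     exists2 psi : onto_map X,
       Psi psi & homeomorphic_maps (diagonal_product phi) psi).

Definition dugundji_space (X : topologicalType) : Prop :=
  [/\ compact [set: X], hausdorff_space X &
      exists2 Psi : onto_map X -> Prop,
        multiplicative_lattice Psi & forall f, Psi f -> open_map f].

Definition coZ (R : realType) (X : topologicalType) : set (set X) :=
  [set U | exists2 f : X -> R, continuous f & U = [set x | f x != 0]].
Arguments coZ : clear implicits.

Definition lattice_closed (T : Type) (P : set (set T)) : Prop :=
  setI_closed P /\ setU_closed P.

Definition gen_lattice (T : Type) (A : set (set T)) : set (set T) :=
  smallest (@lattice_closed T) A.

Definition property_Seq (T : Type) (P : set (set T)) : Prop :=
  forall W, P W -> exists U V : nat -> set T,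
    [/\ forall k, P (U k), forall k, P (V k),
        forall k, U k `<=` ~` V k /\ ~` V k `<=` U k.+1
      & \bigcup_k U k = W].

Definition subset_bang (R : realType) (X : topologicalType)
    (P : set (set X)) : Prop :=
  P `<=` coZ R X /\
  forall (S : set (set X)) (x : X), S `<=` P ->
    ~ closure (\bigcup_(U in S) U) x ->
    exists W, [/\ P W, W x & W `&` \bigcup_(U in S) U = set0].

Definition club (R : realType) (X : topologicalType)
    (C : set (set (set X))) : Prop :=
  [/\ forall P, C P -> [/\ P `<=` coZ R X, countable P & infinite_set P],
      forall A : nat -> set (set X),
        (forall n, A n `<=` A n.+1) -> (forall n, C (A n)) ->
        C (\bigcup_n A n)
    & forall B : set (set X), B `<=` coZ R X -> countable B ->
        exists2 A, C A & B `<=` A].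

Definition d_club (R : realType) (X : topologicalType)
    (C : set (set (set X))) : Prop :=
  club R C /\
  forall P, C P -> [/\ subset_bang R P, property_Seq P & lattice_closed P].

Definition additive_club (T : Type) (C : set (set (set T))) : Prop :=
  forall A1 A2, C A1 -> C A2 -> C (gen_lattice (A1 `|` A2)).

(* Main.v *)
(* For a lattice Q of co-zero sets with the property Seq on a compact Hausdorff
   space X, identify the points that no member of Q separates. Seq makes the
   quotient map f : X -> X_Q a map onto a Hausdorff space, with a basis formed
   by the images of the members of Q, and f is open if and only if Q satisfies
   the relation "subset_bang".
   Given a multiplicative lattice Psi of open maps, the countable lattices with
   Seq whose quotient map is in Psi form an additive d-club: diagonal products
   of maps of Psi correspond to unions of lattices, and cofinality comes from
   (L1) applied to a map with second countable image.
   Given an additive d-club C, let Psi consist of the quotient maps of the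
   unions of the subfamilies D of C that are closed under increasing sequences
   and under the operation of additivity. Such a union inherits "subset_bang",
   although it may be uncountable, by countable closing off inside D. In (L1)
   the weight is controlled by generating D from one member of C for each pair
   of members of a least basis of the image. *)
Require Import Defs.
From HB Require Import structures.
From mathcomp Require Import all_boot all_order all_algebra.
From mathcomp Require Import all_classical all_reals all_analysis.

Set Implicit Arguments.
Unset Strict Implicit.
Unset Printing Implicit Defensive.

Import Order.TTheory GRing.Theory Num.Theory numFieldNormedType.Exports.

Local Open Scope classical_set_scope.
Local Open Scope card_scope.

(** * Cardinals *)

Lemma card_le_injP (T U : Type) (A : set T) (B : set U) (u0 : U) :
  A #<= B <-> exists2 f : T -> U, set_fun A B f & set_inj A f.
Proof.
split=> [/card_leP/injfunPex[f _ finj]|]; last first.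
  by move=> /injfunPex/unsquash f; exact: inj_card_le f.
exists (fun t => if pselect (A t) is left At
                 then \val (f (exist _ t (mem_set At))) else u0).
  by move=> t At; case: pselect => // At'; exact: set_valP.
move=> t u; rewrite !inE => At Au; case: pselect => // At'; case: pselect => // Au'.
move=> /val_inj /finj; rewrite !inE => /(_ I I).
by move=> /(congr1 val).
Qed.

(* Take a maximal set of choice functions for [C] that is injective in every
   coordinate: some coordinate must be onto, and that member of [C] embeds into
   all the others. *)
Lemma least_card (T : Type) (C : set (set T)) : C !=set0 ->
  exists2 A, C A & forall B, C B -> A #<= B.
Proof.
move=> [A0 CA0].
pose I := {A : set T | C A}.
pose P (Z : set (I -> T)) := (forall g, Z g -> forall i, sval i (g i)) /\
  (forall i g h, Z g -> Z h -> g i = h i -> g = h).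
have [|Z [[Zin Zinj] Zmax]] := @Zorn_bigcup _ P.
  move=> F FP Ftot; split=> [g [Z FZ Zg] i|i g h [Z FZ Zg] [Z' FZ' Z'h] gh].
    by have [+ _] := FP _ FZ; apply.
  have [ZZ'|Z'Z] := Ftot _ _ FZ FZ'.
    by have [_ /(_ i g h)] := FP _ FZ'; apply => //; exact: ZZ'.
  by have [_ /(_ i g h)] := FP _ FZ; apply => //; exact: Z'Z.
have [[i Zi]|nosurj] := pselect (exists i : I, forall t, sval i t ->
    exists2 g, Z g & g i = t).
  exists (sval i); first exact: (svalP i).
  move=> B CB; have [->|/set0P[t0 _]] := eqVneq (sval i) set0; first exact: card_ge0.
  apply/(card_le_injP _ _ t0).
  have /boolp.choice[s sP] : forall t, exists g, sval i t -> Z g /\ g i = t.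
    move=> t; have [/Zi[g Zg <-]|nt] := pselect (sval i t); first by exists g.
    by exists (fun _ => t).
  exists (fun t => s t (exist _ B CB)).
    by move=> t /sP[Zs _]; exact: (Zin _ Zs (exist _ B CB)).
  move=> t u; rewrite !inE => it iu st.
  have [Zst <-] := sP _ it; have [Zsu <-] := sP _ iu.
  by rewrite (Zinj _ _ _ Zst Zsu st).
(* If no coordinate is onto, the function [h] of missed values can be added to [Z], against
   maximality. *)
have /boolp.choice[h hP] : forall i : I, exists t, sval i t /\
    ~ exists2 g, Z g & g i = t.
  move=> i; apply: contrapT => /forallNP nt; apply: nosurj; exists i => t it.
  by apply: contrapT => ng; apply: (nt t); split.
have Zh : Z `<` Z `|` [set h].
  split; first by move=> g; left.
  move=> /(_ h (or_intror erefl)) Zh; have [_] := hP (exist _ A0 CA0).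
  by apply; exists h.
exfalso; apply: (Zmax _ Zh); split=> [g [/Zin//|->] i|]; first by have [] := hP i.
move=> i f g [Zf|->] [Zg|->] // fg; first exact: Zinj fg.
- by have [_] := hP i; case; exists f.
- by have [_] := hP i; case; exists g.
Qed.

Lemma card_le_total (T : Type) (A B : set T) : A #<= B \/ B #<= A.
Proof.
have [|C [->|->] CP] := @least_card T [set A; B]; first by exists A; left.
- by left; apply: CP; right.
- by right; apply: CP; left.
Qed.

(* Zorn's lemma on the graphs of injections [seq A -> A]; a maximal [A] has the
   cardinality of [T], since otherwise a disjoint copy of [A] could be added to
   it. *)
Lemma seq_inj_infinite (T : choiceType) : infinite_set [set: T] ->
  exists f : seq T -> T, injective f.
Proof.
move=> infT.
pose dom (G : set (seq T * T)) := [set t | exists u, G ([:: t], u)].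
pose over (A : set T) (s : seq T) := forall t, t \in s -> A t.
(* [dom G] reads the set [A] off the one-letter words. The guard in the last clause admits the empty
   graph, which is the union of the empty chain. *)
pose P G := [/\ forall s u, G (s, u) -> over (dom G) s /\ dom G u,
  forall s u v, G (s, u) -> G (s, v) -> u = v,
  forall s r u, G (s, u) -> G (r, u) -> s = r &
  G !=set0 -> forall s, over (dom G) s -> exists u, G (s, u)].
have domS G H : G `<=` H -> dom G `<=` dom H.
  by move=> GH t [u /GH]; exists u.
have [|G [[Gin Gfun Ginj Gtot] Gmax]] := @Zorn_bigcup _ P.
  move=> F FP Ftot.
  have Fsub G : F G -> G `<=` \bigcup_(G in F) G by move=> FG p Gp; exists G.
  have two G H : F G -> F H -> exists K, [/\ F K, G `<=` K & H `<=` K].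
    by move=> FG FH; have [GH|HG] := Ftot _ _ FG FH; [exists H|exists G]; split.
  split=> [s u [G FG Gsu]|s u v [G FG Gsu] [H FH Hsv]|s r u [G FG Gsu] [H FH Hru]|].
  - have [/(_ _ _ Gsu)[sG uG] _ _ _] := FP _ FG.
    by split=> [t /sG|]; [|move: uG]; apply: domS; exact: Fsub.
  - have [K [FK GK HK]] := two _ _ FG FH; have [_ + _ _] := FP _ FK.
    by move=> /(_ _ _ _ (GK _ Gsu) (HK _ Hsv)).
  - have [K [FK GK HK]] := two _ _ FG FH; have [_ _ + _] := FP _ FK.
    by move=> /(_ _ _ _ (GK _ Gsu) (HK _ Hru)).
  - move=> [p [G0 FG0 G0p]] s sF.
    have [K [FK G0K sK]] : exists K, [/\ F K, G0 `<=` K & over (dom K) s].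
      elim: s sF => [|t s IHs] sF; first by exists G0; split.
      have [|K [FK G0K sK]] := IHs; first by move=> r rs; apply: sF; rewrite inE rs orbT.
      have [|u [H FH Htu]] := sF t; first exact: mem_head.
      have [L [FL KL HL]] := two _ _ FK FH.
      exists L; split=> //; first exact: subset_trans KL.
      move=> r; rewrite inE => /orP[/eqP->|/sK]; last exact: domS.
      by exists u; exact: HL.
    have [_ _ _ Ktot] := FP _ FK.
    have [|u Ksu] := Ktot _ s sK; first by exists p; exact: G0K.
    by exists u, K.
(* The empty graph is not maximal: an injection [e] of [nat] transports the coding [pickle] of
   [seq nat] to words over [range e]. *)
have Gn0 : G !=set0.
  apply: contrapT => /set0P/negP; rewrite negbK => /eqP G0.
  have [t0 _] := infinite_setN0 infT.
  have /(card_le_injP _ _ t0)[e _ einj] := (infiniteP _).1 infT.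
  have {}einj : injective e by move=> m n; apply: einj; rewrite inE.
  pose H := [set p | exists s : seq nat, p = (map e s, e (pickle s))].
  have Hdom : dom H = range e.
    apply/seteqP; split=> [t [u [[|n [|m r]]]] //= [-> _]|_ [n _ <-]]; first by exists n.
    by exists (e (pickle [:: n])), [:: n].
  apply: (Gmax H); first rewrite G0.
    by split=> // /(_ (map e [::], e (pickle ([::] : seq nat)))); apply; exists [::].
  rewrite /P Hdom; split.
  - move=> s u [r [-> ->]]; split; last by exists (pickle r).
    by move=> t /mapP[n _ ->]; exists n.
  - by move=> s u v [r [-> ->]] [r' [/(inj_map einj) <- ->]].
  - move=> s r u [s' [-> ->]] [r' [-> /einj/(pcan_inj pickleK) ->]] //.
  - move=> _ s sr; have [r ->] : exists r, s = map e r.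
      elim: s sr => [|t s IHs] sr; first by exists [::].
      have [|r ->] := IHs; first by move=> u us; apply: sr; rewrite inE us orbT.
      by have [|n _ <-] := sr t; [exact: mem_head|exists (n :: r)].
    by exists (e (pickle r)), r.
have {}Gtot := Gtot Gn0; set A := dom G in Gin Gtot.
have /boolp.choice[F GF] : forall s, exists u, over A s -> G (s, u).
  move=> s; have [/Gtot[u]|ns] := pselect (over A s); first by exists u.
  by have [[_ u] _] := Gn0; exists u.
have FA s : over A s -> A (F s) by move=> /GF/Gin[].
have Finj s r : over A s -> over A r -> F s = F r -> s = r.
  by move=> /GF sF /GF rF FF; apply: Ginj sF _; rewrite FF.
have [[s0 u0] Gp0] := Gn0.
have [/(card_le_injP _ _ u0)[k kA kinj]|/(card_le_injP _ _ u0)[k kA kinj]] :=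
    card_le_total (~` A) A.
  (* If the complement of [A] embeds into [A], every point of [T] is coded by a word over [A], of
     length one or two according to its side; [F] then yields the injection directly. *)
  pose c t := if `[< A t >] then [:: t] else [:: k t; k t].
  have cA t : over A (c t).
    rewrite /c; case: asboolP => [At|/kA kt] r; rewrite !inE ?orbb => /eqP-> //.
  have cinj : injective c.
    move=> t u; rewrite /c; case: asboolP => At; case: asboolP => Au // [] //.
    by move=> kk _; apply: kinj kk; rewrite inE.
  exists (fun s => F (map (F \o c) s)) => s r /Finj.
  have mA q : over A (map (F \o c) q) by move=> t /mapP[u _ ->]; exact: FA.
  move=> /(_ (mA _) (mA _)); apply: inj_map => t u /Finj tu.
  by apply: cinj; exact: tu.
pose k' t := xget t [set u | A u /\ k u = t].
have k'K t : A t -> k' (k t) = t.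
  move=> At; rewrite /k'; case: xgetP => [u _ [Au]|/(_ t)[]//].
  by move=> kut; apply: kinj; rewrite ?inE.
pose c t := if `[< A t >] then [:: t] else [:: k' t; k' t].
pose A2 := A `|` k @` A.
have cA t : A2 t -> over A (c t).
  rewrite /c; case: asboolP => [At _|nAt [//|[u Au <-]]] r; rewrite !inE ?orbb => /eqP-> //.
  by rewrite k'K.
have cinj t u : A2 t -> A2 u -> c t = c u -> t = u.
  move=> t2 u2; rewrite /c; case: asboolP => At; case: asboolP => Au // [] //.
  case: t2 => [//|[v Av <-]]; case: u2 => [//|[w Aw <-]].
  by rewrite !k'K // => -> _.
(* Words over [A] keep their value and all other words over [A2] go to the disjoint copy of [A]
   under [k], so [h] stays injective and extends [G]. *)
pose h s := if `[< over A s >] then F s else k (F (map (F \o c) s)).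
have mA q : over A2 q -> over A (map (F \o c) q).
  by move=> q2 t /mapP[u uq ->]; apply/FA/cA/q2.
have mAinj q r : over A2 q -> over A2 r ->
    map (F \o c) q = map (F \o c) r -> q = r.
  elim: q r => [|t q IHq] [|u r] //= q2 r2 [].
  have t2 : A2 t by apply: q2; exact: mem_head.
  have u2 : A2 u by apply: r2; exact: mem_head.
  move=> /Finj-/(_ (cA _ t2) (cA _ u2))/cinj-/(_ t2 u2) -> qr.
  congr (_ :: _); apply: IHq => // v vs; [apply: q2|apply: r2];
  by rewrite inE vs orbT.
have h2 s : over A2 s -> A2 (h s).
  rewrite /h => s2; case: asboolP => [/FA|_]; first by left.
  by right; exists (F (map (F \o c) s)) => //; apply/FA/mA.
pose H := [set p | over A2 p.1 /\ p.2 = h p.1].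
have Hdom : dom H = A2.
  apply/seteqP; split=> [t [u [+ _]]|t t2]; first by apply; exact: mem_head.
  exists (h [:: t]); split=> //= u; by rewrite inE => /eqP->.
exfalso; apply: (Gmax H).
  split=> [[s u] Gsu|].
    have [sA _] := Gin _ _ Gsu; split=> /=; first by move=> t /sA; left.
    by rewrite /h asboolT //; apply: Gfun Gsu (GF _ sA).
  move=> HG; have [_ Au0] := Gin _ _ Gp0.
  have : H ([:: k u0], h [:: k u0]).
    by split=> //= t; rewrite inE => /eqP->; right; exists u0.
  by move=> /HG/Gin[/(_ (k u0) (mem_head _ _)) + _]; exact: (kA _ Au0).
rewrite /P Hdom; split.
- by move=> s u [/= s2 ->]; split=> //; exact: h2.
- by move=> s u v [_ /= ->] [_ /= ->].
- move=> s r u [/= s2 ->] [/= r2]; rewrite /h.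
  case: asboolP => sA; case: asboolP => rA.
  + exact: Finj.
  + move=> FsA; exfalso; apply: (kA (F (map (F \o c) r))); first exact/FA/mA.
    by rewrite -FsA; exact: FA.
  + move=> FsA; exfalso; apply: (kA (F (map (F \o c) s))); first exact/FA/mA.
    by rewrite FsA; exact: FA.
  + move=> /kinj; rewrite !inE => /(_ (FA _ (mA _ s2)) (FA _ (mA _ r2))).
    by move=> /(Finj _ _ (mA _ s2) (mA _ r2)); exact: mAinj.
- by move=> _ s s2; exists (h s).
Qed.

(** * Quotients defined by families of sets *)

Lemma closed_map_compact (X Y : topologicalType) (f : X -> Y) (C : set X) :
  compact [set: X] -> hausdorff_space Y -> continuous f -> closed C ->
  closed (f @` C).
Proof.
move=> cptX hY cf clC; apply: compact_closed => //.
apply: continuous_compact; first exact: continuous_subspaceT.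
exact: subclosed_compact clC cptX _.
Qed.

(** Saturation makes the complement of the image the image of the complement, which is closed by
    compactness. *)
Lemma open_saturated_image (X Y : topologicalType) (f : X -> Y) (W : set X) :
  compact [set: X] -> hausdorff_space Y -> continuous f ->
  set_surj [set: X] [set: Y] f -> open W ->
  (forall x y, f x = f y -> W x -> W y) -> open (f @` W).
Proof.
move=> cptX hY cf sf oW satW.
have -> : f @` W = ~` (f @` (~` W)).
  apply/seteqP; split=> [_ [x Wx <-] [y nWy fyx]|y nWy].
    by apply: nWy; apply: satW Wx.
  have [x _ fxy] := sf y I; exists x => //.
  by apply: contrapT => nWx; apply: nWy; exists x.
by rewrite openC; apply: closed_map_compact => //; rewrite closedC.
Qed.

(** A continuous map from a compact space onto a Hausdorff space is closed, hence a quotient map. *)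
Lemma factor_through (X Y Z : topologicalType) (f : X -> Y) (g : X -> Z) :
  compact [set: X] -> hausdorff_space Y -> continuous f ->
  set_surj [set: X] [set: Y] f -> continuous g ->
  (forall x y, f x = f y -> g x = g y) ->
  exists2 h : Y -> Z, continuous h & g = h \o f.
Proof.
move=> cptX hY cf sf cg fg.
have /boolp.choice[s sK] : forall y, exists x, f x = y.
  by move=> y; have [x _ <-] := sf y I; exists x.
exists (g \o s); last by apply/funext => x /=; apply: fg; rewrite sK.
apply/continuous_closedP => C clC.
have -> : (g \o s) @^-1` C = f @` (g @^-1` C).
  apply/seteqP; split=> [y Cy|_ [x Cx <-]]; first by exists (s y).
  by rewrite /preimage /= (fg _ x).
by apply: closed_map_compact => //; exact: (continuous_closedP _).1 cg _ clC.
Qed.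

Lemma compact_hausdorff_tychonoff (R : realType) (X : topologicalType) :
  compact [set: X] -> hausdorff_space X -> tychonoff_space X.
Proof.
move=> cptX hX; split=> //; apply: (@normal_completely_regular R).
  exact: compact_normal.
exact: hausdorff_accessible.
Qed.

(** The values of [E] stand for the classes. The topology given below is the final one for the
    projection, as [T] carries none. *)
Definition map_quotient (X : topologicalType) (T : choiceType) (E : X -> T) :=
  set_type (range E).

Section MapQuotient.
Context (X : topologicalType) (T : choiceType) (E : X -> T).

HB.instance Definition _ := Choice.on (map_quotient E).

Definition quotient_proj (x : X) : map_quotient E :=
  exist _ (E x) (mem_set (imageT E x)).

Definition quotient_open (O : set (map_quotient E)) : Prop :=
  open (quotient_proj @^-1` O).

Let quotient_openT : quotient_open setT.
Proof. exact: openT. Qed.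

Let quotient_openI : setI_closed quotient_open.
Proof.
by move=> A B oA oB; rewrite /quotient_open preimage_setI; exact: openI.
Qed.

Let quotient_open_bigU (I : Type) (f : I -> set (map_quotient E)) :
  (forall i, quotient_open (f i)) -> quotient_open (\bigcup_i f i).
Proof.
move=> of_; rewrite /quotient_open preimage_bigcup.
by apply: bigcup_open => i _; exact: of_.
Qed.

HB.instance Definition _ := isOpenTopological.Build (map_quotient E)
  quotient_openT quotient_openI quotient_open_bigU.

End MapQuotient.

Lemma quotient_onto_map (R : realType) (X : topologicalType) (T : choiceType)
    (E : X -> T) : compact [set: X] ->
  (forall x y, E x <> E y -> exists U V : set X,
     [/\ open U /\ open V, U x /\ V y, U `&` V = set0,
         forall a b, E a = E b -> U a -> U b &
         forall a b, E a = E b -> V a -> V b]) ->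
  exists f : onto_map X, forall x y, f x = f y <-> E x = E y.
Proof.
move=> cptX sepE.
pose q := @quotient_proj X T E.
have qE x y : q x = q y <-> E x = E y.
  by split=> [/(congr1 val)//|Exy]; apply: val_inj.
have cq : continuous q by apply/continuousP => O.
have sq : set_surj [set: X] [set: map_quotient E] q.
  move=> y _; have [x _ xy] := set_valP y; exists x => //; exact: val_inj.
have cptQ : compact [set: map_quotient E].
  have -> : [set: map_quotient E] = q @` [set: X].
    by apply/seteqP; split=> // y /sq.
  by apply: continuous_compact => //; exact: continuous_subspaceT.
have oimage U : open U -> (forall a b, E a = E b -> U a -> U b) -> open (q @` U).
  move=> oU satU; rewrite /open /=; change (open (q @^-1` (q @` U))).
  have -> // : q @^-1` (q @` U) = U.
  apply/seteqP; split=> [x [y Uy /qE]|x Ux]; first by move=> /satU; apply.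
  by exists x.
have hQ : hausdorff_space (map_quotient E).
  rewrite open_hausdorff => y z yz.
  have [[a _ ay] [b _ bz]] := (sq y I, sq z I).
  have [|U [V [[oU oV] [Ua Vb] UV satU satV]]] := sepE a b.
    by move=> /qE ab; move: yz; rewrite -ay -bz ab eqxx.
  exists (q @` U, q @` V); split=> /=.
  - by rewrite inE -ay; exists a.
  - by rewrite inE -bz; exists b.
  - exact: oimage.
  - exact: oimage.
  - apply/eqP; rewrite -subset0 => _ [[c Uc <-] [d Vd /qE dc]].
    have : (U `&` V) c by split=> //; exact: satV dc Vd.
    by rewrite UV.
by exists (OntoMap (compact_hausdorff_tychonoff R cptQ hQ) cq sq).
Qed.

(** Words replace finite subfamilies, so that counting meets reduces to counting words; the empty
    word yields the whole space. *)
Definition finite_meet (T : Type) (Q : set (set T)) (s : seq (set_type Q)) :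
  set T := \big[setI/setT]_(W <- s) \val W.

Lemma finite_meet_cat (T : Type) (Q : set (set T)) (s r : seq (set_type Q)) :
  finite_meet (s ++ r) = finite_meet s `&` finite_meet r.
Proof. exact: big_cat. Qed.

Lemma finite_meet_closed (T : Type) (Q : set (set T)) (s : seq (set_type Q)) :
  setI_closed Q -> (setT |` Q) (finite_meet s).
Proof.
move=> QI; rewrite /finite_meet; elim/big_rec: _ => [|W A _ [->|QA]]; first by left.
- by rewrite setIT; right; exact: set_valP.
- by right; apply: QI => //; exact: set_valP.
Qed.

(** If [W] contains [x] but not [y], then [x] lies in some [U k], while [y] is outside [U k.+1] and
    hence in [V k], which is disjoint from [U k]. *)
Lemma Seq_separates (T : Type) (Q : set (set T)) (W : set T) (x y : T) :
  property_Seq Q -> Q W -> ~ (W x <-> W y) ->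
  exists U V, [/\ Q U /\ Q V, U x, V y & U `&` V = set0].
Proof.
move=> SeqQ QW; have [U [V [QU QV UV WU]]] := SeqQ _ QW.
have UVk k : U k `&` V k = set0.
  by rewrite -subset0 => z [/(UV k).1]; exact.
have sep a b : W a -> ~ W b -> exists k, [/\ U k a, V k b & U k `&` V k = set0].
  rewrite -{1}WU => -[k _ Uka] nWb; exists k; split=> //.
  apply: contrapT => /(UV k).2 Ukb; apply: nWb; rewrite -WU.
  by exists k.+1.
have [Wx|nWx] := pselect (W x); have [Wy|nWy] := pselect (W y) => nxy.
- by exfalso; apply: nxy.
- by have [k [? ? ?]] := sep _ _ Wx nWy; exists (U k), (V k).
- by have [k [? ? ?]] := sep _ _ Wy nWx; exists (V k), (U k); rewrite setIC.
- by exfalso; apply: nxy.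
Qed.

(* The filter of small finite meets around [x] turns the finite subcover
   argument into one application of the near-covering form of compactness. *)
Lemma compact_separation (X : topologicalType) (Q : set (set X)) (K : set X)
    (x : X) :
  Q `<=` open -> property_Seq Q -> compact K ->
  (forall k, K k -> exists2 W, Q W & ~ (W x <-> W k)) ->
  exists2 s : seq (set_type Q), finite_meet s x & K `&` finite_meet s = set0.
Proof.
move=> Qo SeqQ /compact_near_coveringP cK sepK.
(* [F] lives on the power set of [X]: a property holds along it when all subsets of some finite meet
   around [x] have it. *)
pose F : set_system (set X) := [set A | exists2 s : seq (set_type Q),
  finite_meet s x & forall V, V `<=` finite_meet s -> A V].
have FF : Filter F.
  split=> [|A B [s sx sA] [r rx rB]|A B AB [s sx sA]].
  - by exists [::] => //; rewrite /finite_meet big_nil.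
  - exists (s ++ r) => [|V]; rewrite finite_meet_cat // => Vsr.
    by split; [apply: sA|apply: rB] => y /Vsr[].
  - by exists s => // V /sA /AB.
have [|s sx /(_ _ (@subset_refl _ _)) Ks] :=
    cK _ F (fun V k => ~ V k) FF.
  move=> k /sepK[W QW /(Seq_separates SeqQ QW)[U [V [[QU QV] Ux Vk UV]]]].
  exists (V, [set A | A `<=` U]).
    split; first by apply: open_nbhs_nbhs; split=> //; exact: Qo.
    exists [:: exist _ U (mem_set QU)]; rewrite /finite_meet big_seq1 //.
  move=> [y A] [/= Vy AU] Ay; have : (U `&` V) y by split=> //; exact: AU.
  by rewrite UV.
by exists s => //; rewrite -subset0 => y [/Ks].
Qed.

(** This ties an onto map to a family of sets; on a compact space it determines the map up to
    homeomorphism, by [homeomorphic_same_fibers]. *)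
Definition same_fibers (X T : Type) (f : X -> T) (Q : set (set X)) : Prop :=
  forall x y, f x = f y <-> forall W, Q W -> (W x <-> W y).

Lemma Seq_quotient (R : realType) (X : topologicalType) (Q : set (set X)) :
  compact [set: X] -> Q `<=` open -> property_Seq Q ->
  exists f : onto_map X, same_fibers f Q.
Proof.
move=> cptX Qo SeqQ; pose E (x : X) : set (set X) := [set W | Q W /\ W x].
have EP x y : E x = E y <-> forall W, Q W -> (W x <-> W y).
  split=> [Exy W QW|xy].
    split=> Wz; first by have [] : E y W by rewrite -Exy.
    by have [] : E x W by rewrite Exy.
  by apply/seteqP; split=> W [QW /(xy _ QW)].
have [x y /EP/existsNP[W /not_implyP[QW nW]]|f fE] := @quotient_onto_map R X _ E cptX.
  have [U [V [[QU QV] Ux Vy UV]]] := Seq_separates SeqQ QW nW.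
  exists U, V; split=> //; first by split; exact: Qo.
  - by move=> a b /EP/(_ _ QU)[].
  - by move=> a b /EP/(_ _ QV)[].
by exists f => x y; apply: (iff_trans (fE x y)); exact: EP.
Qed.

Lemma image_hausdorff (X : topologicalType) (f : onto_map X) :
  hausdorff_space (image_space f).
Proof. by have [] := onto_tychonoff f. Qed.

(** Take a neighborhood [A] of [x] with closure in [O], and [W] around [x] missing every member of
    [Q] disjoint from [A]. If the fiber of some [z] in [W] missed [O], compactness would give a
    finite meet around [z] disjoint from [A], which [W] would have to miss. Hence the image of [W]
    is an open set inside that of [O]. Allowing [setT] as [W] covers the empty family. *)
Lemma bang_open_map (X : topologicalType) (f : onto_map X) (Q : set (set X)) :
  compact [set: X] -> hausdorff_space X -> Q `<=` open -> setI_closed Q ->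
  property_Seq Q -> same_fibers f Q ->
  (forall (S : set (set X)) (x : X), S `<=` Q ->
    ~ closure (\bigcup_(U in S) U) x ->
    exists W, [/\ (setT |` Q) W, W x & W `&` \bigcup_(U in S) U = set0]) ->
  open_map f.
Proof.
move=> cptX hX Qo QI SeqQ fQ bangQ O oO.
have cf := @onto_continuous _ f; have sf := @onto_surj _ f.
rewrite openE => _ [x Ox <-].
have [A nA AO] : exists2 A, nbhs x A & closure A `<=` O.
  exact: (@compact_regular X x setT hX cptX filterT _ (open_nbhs_nbhs (conj oO Ox))).
have nAx := nbhs_singleton nA.
pose S := [set V | Q V /\ V `&` A = set0].
have [|clS|W [QW Wx WS]] := bangQ S x.
- by move=> V [].
- have [y [[V [QV VA] Vy] Ay]] := clS _ nA.
  by have : (V `&` A) y by []; rewrite VA.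
have satW a b : f a = f b -> W a -> W b.
  by case: QW => [-> //|QW] /fQ/(_ _ QW)[].
have oW : open W by case: QW => [->|/Qo//]; exact: openT.
have WO : f @` W `<=` f @` O.
  move=> _ [z Wz <-]; apply: contrapT => nfz.
  have [||s sz] := @compact_separation X Q (closure A) z Qo SeqQ.
  - exact: subclosed_compact (@closed_closure _ _) cptX _.
  - move=> k /AO Ok; apply: contrapT => nW; apply: nfz; exists k => //.
    apply/esym/fQ => V QV; apply: contrapT => nV; apply: nW; exists V => //.
  - have [sT|Qs] := finite_meet_closed s QI.
      by rewrite sT setIT => A0; have := subset_closure nAx; rewrite A0.
    move=> As; have : (W `&` \bigcup_(U in S) U) z.
      split=> //; exists (finite_meet s) => //; split=> //.
      by rewrite -subset0 => y [sy Ay]; rewrite -As; split=> //; exact: subset_closure.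
    by rewrite WS.
apply: (@filterS _ _ _ (f @` W)) => //; apply: open_nbhs_nbhs; split.
  by apply: open_saturated_image => //; exact: image_hausdorff.
by exists x.
Qed.

(** * Co-zero sets *)

Lemma countable_image (T U : Type) (f : T -> U) (A : set T) :
  countable A -> countable (f @` A).
Proof. exact/sub_countable/card_image_le. Qed.

Lemma countableU (T : Type) (A B : set T) :
  countable A -> countable B -> countable (A `|` B).
Proof.
move=> cA cB; rewrite -bigcup2E; apply: bigcup_countable => //.
by move=> [|[|n]] _ /=.
Qed.

Lemma nondecreasing_unions (T U : Type) (A : nat -> set T) (B : nat -> set U) :
  (forall n, A n `<=` A n.+1) -> (forall n, B n `<=` B n.+1) ->
  forall a b, (\bigcup_n A n) a -> (\bigcup_n B n) b -> exists n, A n a /\ B n b.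
Proof.
move=> A1 B1 a b [n _ Aa] [m _ Bb].
have mono V (C : nat -> set V) i j : (forall n, C n `<=` C n.+1) -> C i `<=` C (i + j)%N.
  move=> C1; elim: j => [|j IHj]; first by rewrite addn0.
  by rewrite addnS; apply: subset_trans (C1 _).
exists (n + m)%N; split; first exact: mono.
by rewrite addnC; exact: mono.
Qed.

(** Closing off as in the downward Löwenheim-Skolem theorem: countably many rounds suffice, because
    two arguments always occur at a common stage. *)
Lemma countable_closure (T : Type) (I : countType) (op : I -> T -> T -> T)
    (D B : set T) :
  (forall i a b, D a -> D b -> D (op i a b)) -> B `<=` D -> countable B ->
  exists Q, [/\ B `<=` Q, Q `<=` D, countable Q &
    forall i a b, Q a -> Q b -> Q (op i a b)].
Proof.
move=> Dop BD cB.
pose step Q := Q `|` (fun p : T * T * I => op p.2 p.1.1 p.1.2) @`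
  ((Q `*` Q) `*` [set: I]).
pose A n := iter n step B.
have A1 n : A n `<=` A n.+1 by move=> t; left.
exists (\bigcup_n A n); split.
- by move=> t Bt; exists 0%N.
- move=> t [n _]; elim: n t => [|n IHn] t; first exact: BD.
  by move=> [/IHn//|[[[a b] i] [[/= /IHn Da /IHn Db] _] <-]]; exact: Dop.
- apply: bigcup_countable => // n _; elim: n => // n IHn.
  apply: countableU => //; apply: countable_image.
  by apply: countableX => //; exact: countableX.
- move=> i a b Qa Qb; have [n [Ana Anb]] := nondecreasing_unions A1 A1 Qa Qb.
  by exists n.+1 => //; right; exists (a, b, i).
Qed.

Section Cozero.
Local Open Scope ring_scope.

Lemma coZ_open (R : realType) (X : topologicalType) : coZ R X `<=` open.
Proof.
move=> _ [f cf ->]; have -> : [set x | f x != 0] = f @^-1` (~` [set 0]).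
  by apply/seteqP; split=> x /eqP.
move/continuousP: cf; apply; rewrite openC.
by apply: accessible_closed_set1; apply: hausdorff_accessible; exact: Rhausdorff.
Qed.

Lemma coZ_preimage (R : realType) (X Y : topologicalType) (f : X -> Y) (W : set Y) :
  continuous f -> coZ R Y W -> coZ R X (f @^-1` W).
Proof.
move=> cf [g cg ->]; exists (g \o f) => // x.
by apply: continuous_comp; [exact: cf|exact: cg].
Qed.

Lemma coZ_set0 (R : realType) (X : topologicalType) : coZ R X set0.
Proof.
exists (fun=> 0); first exact: cst_continuous.
by apply/seteqP; split=> x //=; rewrite eqxx.
Qed.

Lemma coZ_lattice (R : realType) (X : topologicalType) : lattice_closed (coZ R X).
Proof.
split=> _ _ [f cf ->] [g cg ->].
  exists (f \* g) => [x|]; first exact: continuousM (cf x) (cg x).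
  by apply/seteqP; split=> x /=; rewrite mulf_eq0 negb_or => /andP.
exists (fun x => `|f x| + `|g x|) => [x|].
  by apply: cvgD; apply: cvg_norm; [exact: cf|exact: cg].
apply/seteqP; split=> x /=; rewrite paddr_eq0 // !normr_eq0 negb_and => /orP //.
Qed.

Lemma coZ_lt (R : realType) (X : topologicalType) (f g : X -> R) :
  continuous f -> continuous g -> coZ R X [set x | f x < g x].
Proof.
(* This function is twice the positive part of [g - f]. *)
move=> cf cg; exists (fun x => (g x - f x) + `|g x - f x|) => [x|].
  have c : (g y - f y) @[y --> x] --> g x - f x.
    by apply: cvgB; [exact: cg|exact: cf].
  by apply: cvgD => //; exact: cvg_norm.
apply/seteqP; split=> x /=; have [fg|gf] := ltP (f x) (g x) => //.
- by rewrite ger0_norm ?subr_ge0 ?ltW// paddr_eq0 ?subr_ge0 ?ltW// andbb subr_eq0 gt_eqF.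
- by rewrite ler0_norm ?subr_le0// subrr eqxx.
Qed.

Lemma invS_lt (R : realType) (k : nat) : k.+2%:R^-1 < k.+1%:R^-1 :> R.
Proof. by rewrite ltf_pV2 ?posrE ?ltr0n// ltr_nat. Qed.

Lemma invS_small (R : realType) (e : R) : 0 < e -> exists k : nat, k.+1%:R^-1 < e.
Proof.
move=> e0; have [k _ ke] := near_infty_natSinv_lt (PosNum e0).
by exists k; apply: ke => /=.
Qed.

(** The complement of [V k] is the closed level set of [|g|] at [1/(k+1)], which lies between the
    open level sets at [1/(k+1)] and at [1/(k+2)]. *)
Lemma coZ_Seq (R : realType) (X : topologicalType) : property_Seq (coZ R X).
Proof.
move=> _ [g cg ->]; have cn : continuous (fun x => `|g x|).
  by move=> x; apply: cvg_norm; exact: cg.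
exists (fun k => [set x | k.+1%:R^-1 < `|g x|]).
exists (fun k => [set x | `|g x| < k.+1%:R^-1]); split.
- by move=> k; apply: coZ_lt => //; exact: cst_continuous.
- by move=> k; apply: coZ_lt => //; exact: cst_continuous.
- move=> k; split=> x /= => [gx|/negP]; first by apply/negP; rewrite -leNgt ltW.
  by rewrite -leNgt; apply: lt_le_trans; exact: invS_lt.
- apply/seteqP; split=> [x [k _] /= gx|x /=]; rewrite -normr_gt0.
    by apply: lt_trans gx; rewrite invr_gt0.
  by move=> /invS_small[k]; exists k.
Qed.

End Cozero.

Lemma countable_Seq_lattice (R : realType) (X : topologicalType)
    (B : set (set X)) : B `<=` coZ R X -> countable B ->
  exists Q, [/\ B `<=` Q, Q `<=` coZ R X, countable Q, lattice_closed Q &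
    property_Seq Q].
Proof.
move=> BZ cB.
have /boolp.choice[S SP] : forall W : set X, exists UV : (nat -> set X) * (nat -> set X),
    coZ R X W -> [/\ forall k, coZ R X (UV.1 k), forall k, coZ R X (UV.2 k),
        forall k, UV.1 k `<=` ~` UV.2 k /\ ~` UV.2 k `<=` UV.1 k.+1
      & \bigcup_k UV.1 k = W].
  move=> W; have [/coZ_Seq[U [V UV]]|nW] := pselect (coZ R X W); first by exists (U, V).
  by exists (fun=> set0, fun=> set0).
(* The index selects meet, join, or one of the Skolem functions witnessing Seq; the latter depend on
   the first argument only. *)
pose op (i : option (option nat) * nat) (A C : set X) := match i with
  | (None, _) => A `&` C | (Some None, _) => A `|` C
  | (Some (Some 0), k) => (S A).1 k | (Some (Some _), k) => (S A).2 k end.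
have [|Q [BQ QZ cQ Qop]] := @countable_closure _ _ op _ _ _ BZ cB.
  have [ZI ZU] := @coZ_lattice R X.
  move=> [[[[|n]|]|] k] A C ZA ZC /=; [| |exact: ZU|exact: ZI].
  - by have [] := SP _ ZA.
  - by have [] := SP _ ZA.
exists Q; split=> //.
  split=> A C QA QC; first exact: (Qop (None, 0) _ _ QA QC).
  exact: (Qop (Some None, 0) _ _ QA QC).
move=> W QW; have [_ _ SW WE] := SP _ (QZ _ QW).
exists (S W).1, (S W).2; split=> // k.
  exact: (Qop (Some (Some 0), k) _ _ QW QW).
exact: (Qop (Some (Some 1), k) _ _ QW QW).
Qed.

Lemma gen_lattice_closed (T : Type) (A : set (set T)) :
  lattice_closed (gen_lattice A).
Proof.
split=> U V AU AV M [MC AM].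
  by apply: MC.1; [exact: AU|exact: AV].
by apply: MC.2; [exact: AU|exact: AV].
Qed.

Lemma sub_gen_lattice (T : Type) (A : set (set T)) : A `<=` gen_lattice A.
Proof. exact: sub_gen_smallest. Qed.

(** The sets with witnessing sequences in the generated lattice form a lattice: by De Morgan, the
    [V k] are combined by the operation dual to that of the [U k]. *)
Lemma gen_lattice_Seq (T : Type) (A : set (set T)) :
  property_Seq A -> property_Seq (gen_lattice A).
Proof.
move=> SeqA; have [GI GU] := gen_lattice_closed A.
pose M := [set W | exists U V : nat -> set T,
    [/\ forall k, gen_lattice A (U k), forall k, gen_lattice A (V k),
        forall k, U k `<=` ~` V k /\ ~` V k `<=` U k.+1
      & \bigcup_k U k = W]].
suff : gen_lattice A `<=` M by [].
apply: smallest_sub => [|W /SeqA[U [V [AU AV UV WU]]]]; last first.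
  by exists U, V; split=> // k; exact: sub_gen_lattice.
(* Monotonicity provides a common index when two unions are intersected. *)
have mono (U V : nat -> set T) :
    (forall k, U k `<=` ~` V k /\ ~` V k `<=` U k.+1) -> forall k, U k `<=` U k.+1.
  by move=> UV k x /(UV k).1/(UV k).2.
split=> W1 W2 [U1 [V1 [AU1 AV1 UV1 <-]]] [U2 [V2 [AU2 AV2 UV2 <-]]].
  exists (fun k => U1 k `&` U2 k), (fun k => V1 k `|` V2 k); split.
  - by move=> k; exact: GI.
  - by move=> k; exact: GU.
  - move=> k; rewrite setCU; split=> x [x1 x2].
      by split; [exact: (UV1 k).1|exact: (UV2 k).1].
    by split; [exact: (UV1 k).2|exact: (UV2 k).2].
  - apply/seteqP; split=> [x [k _ [x1 x2]]|x [x1 x2]].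
      by split; exists k.
    have [k [x1' x2']] := nondecreasing_unions (mono _ _ UV1) (mono _ _ UV2) x1 x2.
    by exists k.
exists (fun k => U1 k `|` U2 k), (fun k => V1 k `&` V2 k); split.
- by move=> k; exact: GU.
- by move=> k; exact: GI.
- move=> k; rewrite setCI; split=> x [x1|x1].
  + by left; exact: (UV1 k).1.
  + by right; exact: (UV2 k).1.
  + by left; exact: (UV1 k).2.
  + by right; exact: (UV2 k).2.
- by rewrite bigcupU.
Qed.

Lemma preimage_lattice_closed (X Y : Type) (f : X -> Y) (Q : set (set Y)) :
  lattice_closed Q -> lattice_closed [set f @^-1` W | W in Q].
Proof.
move=> [QI QU]; split=> _ _ [U QU' <-] [V QV <-].
  by exists (U `&` V); [exact: QI|rewrite preimage_setI].
by exists (U `|` V); [exact: QU|rewrite preimage_setU].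
Qed.

Lemma preimage_Seq (X Y : Type) (f : X -> Y) (Q : set (set Y)) :
  property_Seq Q -> property_Seq [set f @^-1` W | W in Q].
Proof.
move=> SeqQ _ [W /SeqQ[U [V [QU QV UV <-]]] <-].
exists (fun k => f @^-1` U k), (fun k => f @^-1` V k); split.
- by move=> k; exists (U k).
- by move=> k; exists (V k).
- by move=> k; split=> x; [exact: (UV k).1|exact: (UV k).2].
- by rewrite preimage_bigcup.
Qed.

(** * Bases and separation of points *)

Lemma basisP (X : topologicalType) (B : set (set X)) : basis B <->
  B `<=` open /\ forall (x : X) O, open O -> O x ->
    exists U, [/\ B U, U x & U `<=` O].
Proof.
split=> -[Bo Bx]; split=> // x O.
  move=> oO Ox; have [U [BU Ux] UO] := Bx x _ (open_nbhs_nbhs (conj oO Ox)).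
  by exists U.
rewrite nbhsE => -[V [oV Vx] VO]; have [U [BU Ux UV]] := Bx x V oV Vx.
by exists U => //; exact: subset_trans UV VO.
Qed.

(** Indexing by pairs of basic sets ties the size of the family to the weight. [G] picks a co-zero
    set between the members of a pair whenever there is one, and complete regularity supplies a
    suitable pair for any two points. *)
Lemma coZ_separating_points (R : realType) (Y : topologicalType)
    (B : set (set Y)) : tychonoff_space Y -> basis B ->
  exists G : set Y * set Y -> set Y, (forall p, coZ R Y (G p)) /\
    forall y z, y <> z -> exists2 p, (B `*` B) p & G p y /\ ~ G p z.
Proof.
move=> [hY crY] /basisP[Bo BP].
have /boolp.choice[G GP] : forall p : set Y * set Y, exists W, coZ R Y W /\
    ((exists W', [/\ coZ R Y W', p.1 `<=` W' & W' `<=` p.2]) ->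
     p.1 `<=` W /\ W `<=` p.2).
  move=> p; have [[W [ZW pW Wp]]|nW] :=
    pselect (exists W', [/\ coZ R Y W', p.1 `<=` W' & W' `<=` p.2]).
    by exists W.
  by exists set0; split=> [|//]; exact: coZ_set0.
exists G; split=> [p|y z yz]; first by have [] := GP p.
have cl1 : closed [set z].
  by apply: accessible_closed_set1; exact: hausdorff_accessible.
have [V [BV Vy Vz]] : exists V, [/\ B V, V y & V `<=` ~` [set z]].
  by apply: BP => //; rewrite openC.
have /(@uniform_separatorP _ R)[f [cf _ fy fV]] : uniform_separator [set y] (~` V).
  by apply: crY; [rewrite closedC; exact: Bo|].
pose W := [set x : Y | (f x < 1)%R].
have ZW : coZ R Y W by apply: coZ_lt => //; exact: cst_continuous.
have Wy : W y by rewrite /W /= (fy (f y)) ?ltr01//; exists y.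
have WV : W `<=` V.
  move=> x; rewrite /W /= => fx1; apply: contrapT => nVx.
  by move: fx1; rewrite (fV (f x)) ?ltxx//; exists x.
have [U [BU Uy UW]] := BP y W (coZ_open ZW) Wy.
have [_ [|UG GV]] := GP (U, V); first by exists W.
by exists (U, V) => //; split=> [|Gz]; [exact: UG|exact: (Vz _ (GV _ Gz))].
Qed.

(** By compactness some finite meet around [x] misses the preimage of the complement of [O]. This
    bounds the size of a least basis of the image by the number of words over [Q]. *)
Lemma meets_basis (X : topologicalType) (f : onto_map X) (Q : set (set X)) :
  compact [set: X] -> Q `<=` open -> property_Seq Q -> same_fibers f Q ->
  basis (range (fun s : seq (set_type Q) => f @` finite_meet s)).
Proof.
move=> cptX Qo SeqQ fQ; have cf := @onto_continuous _ f.
apply/basisP; split=> [_ [s _ <-]|y O oO Oy].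
  apply: open_saturated_image => //; first exact: image_hausdorff.
  - exact: onto_surj.
  - rewrite /finite_meet; elim/big_rec: _ => [|W A _ oA]; first exact: openT.
    by apply: openI => //; apply: Qo; exact: set_valP.
  - move=> a b /fQ ab; rewrite /finite_meet; elim/big_rec: _ => // W A _ IH [Wa Aa].
    by split; [apply/(ab _ (set_valP W))|exact: IH].
have [x _ fxy] := @onto_surj _ f y I.
have [||s sx Ks] := @compact_separation X Q (f @^-1` (~` O)) x Qo SeqQ.
- apply: subclosed_compact cptX _ => //.
  by move/continuous_closedP: cf; apply; rewrite closedC.
- move=> k nOk; apply: contrapT => nW; apply: nOk; rewrite /=.
  have -> // : f k = y.
  rewrite -fxy; apply/esym/fQ => W QW; apply: contrapT => nWk.
  by apply: nW; exists W.
exists (f @` finite_meet s); split; [by exists s|by exists x|].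
move=> _ [z sz <-]; apply: contrapT => nOz.
have : (f @^-1` (~` O) `&` finite_meet s) z by [].
by rewrite Ks.
Qed.

Lemma countable_seq (T : Type) (Q : set T) : countable Q ->
  countable [set: seq (set_type Q)].
Proof.
move=> /card_leP/injfunPex[e _ einj]; apply/card_le_injP; first exact: 0%N.
exists (fun s => pickle (map (fun x => val (e x)) s)) => // s r _ _.
move=> /(pcan_inj pickleK)/inj_map; apply => x y /val_inj.
by apply: einj; rewrite inE.
Qed.

Lemma least_basis_exists (X : topologicalType) : exists B : set (set X), least_basis B.
Proof.
have [|B bB Bmin] := @least_card (set X) basis; last by exists B.
exists open; apply/basisP; split=> // x O oO Ox.
by exists O; split.
Qed.

(** * From multiplicative lattices to clubs *)

(** The union of [S] is saturated and [f] is open, so the closure of the union misses the whole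
    fiber of [x], not only [x]. Compactness then separates [x] from this closure by a finite
    meet. *)
Lemma open_map_bang (R : realType) (X : topologicalType) (f : onto_map X)
    (Q : set (set X)) :
  compact [set: X] -> Q `<=` coZ R X -> Q !=set0 ->
  lattice_closed Q -> property_Seq Q -> same_fibers f Q -> open_map f ->
  subset_bang R Q.
Proof.
move=> cptX QZ [W0 QW0] [QI _] SeqQ fQ fo; split=> // S x SQ xS.
have Qo : Q `<=` open by move=> W /QZ/coZ_open.
have cf := @onto_continuous _ f.
(* The finite meet found below may be [setT], so it is cut down by a member of [Q] around [x]; if
   [W0] misses [x], Seq provides [V 0]. *)
have [W1 QW1 W1x] : exists2 W, Q W & W x.
  have [W0x|nW0x] := pselect (W0 x); first by exists W0.
  have [U [V [_ QV UV WU]]] := SeqQ _ QW0; exists (V 0) => //.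
  apply: contrapT => /(UV 0).2 U1x; apply: nW0x; rewrite -WU; by exists 1.
have [|k Kk|s sx Ks] :=
    @compact_separation X Q (closure (\bigcup_(U in S) U)) x Qo SeqQ.
- exact: subclosed_compact (@closed_closure _ _) cptX _.
- apply: contrapT => nW; apply: xS => O nO.
  have fxk : f k = f x.
    by apply/esym/fQ => V QV; apply: contrapT => nV; apply: nW; exists V.
  move: nO; rewrite nbhsE => -[G [oG Gx] GO].
  have /cf : nbhs (f k) (f @` G).
    by rewrite fxk; apply: open_nbhs_nbhs; split; [exact: fo|exists x].
  move=> /Kk[y [[U SU Uy] [z Gz fzy]]]; exists z; split; last exact: GO.
  by exists U => //; exact: (((fQ z y).1 fzy) U (SQ _ SU)).2.
exists (W1 `&` finite_meet s); split=> //.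
  by have [->|Qs] := finite_meet_closed s QI; [rewrite setIT|exact: QI].
rewrite -subset0 => y [[_ sy] Sy].
by rewrite -Ks; split=> //; exact: subset_closure.
Qed.

Lemma diagonal_fibers (X : topologicalType) (J : Type) (phi : J -> onto_map X)
    (psi : onto_map X) (x y : X) :
  homeomorphic_maps (diagonal_product phi) psi ->
  psi x = psi y <-> forall a, phi a x = phi a y.
Proof.
move=> [h [k [hK _ _ _]] dE].
have dEx z : diagonal_product phi z = h (psi z) by rewrite dE.
split=> [xy a|xy].
  have /(congr1 val) /= dxy : diagonal_product phi x = diagonal_product phi y.
    by rewrite !dEx xy.
  exact: (congr1 (fun u => u a) dxy).
apply: (can_inj hK); rewrite -!dEx; apply: val_inj => /=.
by apply: functional_extensionality_dep => a; exact: xy.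
Qed.

Lemma gen_lattice_fibers (T : Type) (A : set (set T)) (x y : T) :
  (forall W, A W -> (W x <-> W y)) ->
  forall W, gen_lattice A W -> (W x <-> W y).
Proof.
move=> Axy; suff : gen_lattice A `<=` [set W | W x <-> W y] by [].
apply: smallest_sub => //; split=> U V /= Uxy Vxy.
  by split=> -[/Uxy Ux /Vxy].
by split=> -[/Uxy|/Vxy]; by [left|right].
Qed.

Lemma gen_lattice_coZ (R : realType) (X : topologicalType) (A : set (set X)) :
  A `<=` coZ R X -> gen_lattice A `<=` coZ R X.
Proof. by move=> AZ; apply: smallest_sub => //; exact: coZ_lattice. Qed.

Lemma gen_lattice_countable (R : realType) (X : topologicalType)
    (A : set (set X)) :
  A `<=` coZ R X -> countable A -> countable (gen_lattice A).
Proof.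
move=> AZ cA; have [Q [AQ _ cQ QL _]] := countable_Seq_lattice AZ cA.
by apply: sub_countable cQ; apply: subset_card_le; exact: smallest_sub.
Qed.

Lemma SeqU (T : Type) (A B : set (set T)) :
  property_Seq A -> property_Seq B -> property_Seq (A `|` B).
Proof.
move=> SA SB W [/SA|/SB][U [V [PU PV UV WU]]]; exists U, V; split=> // k;
  by [left|right].
Qed.

Lemma Seq_bigcup (T I : Type) (D : set I) (A : I -> set (set T)) :
  (forall i, D i -> property_Seq (A i)) -> property_Seq (\bigcup_(i in D) A i).
Proof.
move=> SA W [i Di /(SA i Di)[U [V [PU PV UV WU]]]].
by exists U, V; split=> // k; exists i.
Qed.

Lemma lattice_closed_bigcup (T : Type) (A : nat -> set (set T)) :
  (forall n, A n `<=` A n.+1) -> (forall n, lattice_closed (A n)) ->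
  lattice_closed (\bigcup_n A n).
Proof.
move=> A1 AL; split=> U V AU AV;
  have [n [AnU AnV]] := nondecreasing_unions A1 A1 AU AV; exists n => //.
  exact: (AL n).1.
exact: (AL n).2.
Qed.

(** Co-zero sets separate points, so finitely many of them would embed [X] into a finite power of
    [bool]. *)
Lemma infinite_coZ (R : realType) (X : topologicalType) :
  infinite_set [set: X] -> compact [set: X] -> hausdorff_space X ->
  infinite_set (coZ R X).
Proof.
move=> infX cptX hX /finite_seqP[s sE]; apply: infX.
have tX := compact_hausdorff_tychonoff R cptX hX.
have [B lB] := least_basis_exists X.
have [G [ZG sepG]] := coZ_separating_points R tX lB.1.
pose e (x : X) := [ffun i : 'I_(size s) => `[< nth set0 s i x >]].
have einj : injective e.
  move=> x y exy; apply: contrapT => xy; have [p _ [Gx nGy]] := sepG x y xy.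
  have ps : G p \in s by have : coZ R X (G p) by []; rewrite sE.
  have ip : (index (G p) s < size s)%N by rewrite index_mem.
  have /ffunP/(_ (Ordinal ip)) := exy; rewrite !ffunE /= nth_index //.
  by rewrite asboolT // asboolF.
rewrite -(preimage_setT e); apply: finite_preimage => [x y _ _ /einj//|].
exact: finite_finset.
Qed.

(** The sign bit turns upper bounds into lower ones: [V k] bounds the signed function above by
    [c k], which is a cut of the opposite sign. The rationals [c k] decrease to [q]. *)
Lemma rational_cuts_Seq (R : realType) (X I : Type) (g : I -> X -> R) (D : set I) :
  property_Seq ((fun p => [set x | ratr p.2 < (-1) ^+ p.1.2 * g p.1.1 x]%R) @`
    ((D `*` [set: bool]) `*` [set: rat])).
Proof.
move=> _ [[[i b] q] [[/= Di _] _] <-] /=.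
pose c k : rat := (q + k.+1%:R^-1)%R.
have cE k : ratr (c k) = (ratr q + k.+1%:R^-1 :> R)%R.
  by rewrite /c rmorphD /= fmorphV rmorph_nat.
exists (fun k => [set x | ratr (c k) < (-1) ^+ b * g i x]%R).
exists (fun k => [set x | ratr (- c k) < (-1) ^+ (~~ b) * g i x]%R).
have negE k x : (ratr (- c k) < (-1) ^+ (~~ b) * g i x)%R =
    ((-1) ^+ b * g i x < ratr (c k))%R.
  by rewrite rmorphN /= signrN mulNr ltrN2.
split=> [k|k|k|]; first by exists (i, b, c k).
- by exists (i, ~~ b, - c k)%R.
- split=> x /=; rewrite negE; first by move=> cx; apply/negP; rewrite -leNgt ltW.
  move=> /negP; rewrite -leNgt; apply: lt_le_trans.
  by rewrite !cE ltrD2l invS_lt.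
- apply/seteqP; split=> [x [k _] /=|x /=].
    by apply: lt_trans; rewrite cE ltrDl invr_gt0 ltr0n.
  rewrite -subr_gt0 => /invS_small[k kx]; exists k => //=.
  by rewrite cE addrC -ltrBrDr.
Qed.

(** The quotient is taken by rational cuts of the functions [g W], and not by the sets [W]
    themselves: points that no cut separates share the values of [g W], which therefore factors
    through [f] and exhibits [W] as the preimage of a co-zero set. *)
Lemma second_countable_map (R : realType) (X : topologicalType)
    (B : set (set X)) : compact [set: X] -> B `<=` coZ R X -> countable B ->
  exists f : onto_map X, @second_countable (image_space f) /\
    forall W, B W -> exists2 O, coZ R (image_space f) O & W = f @^-1` O.
Proof.
move=> cptX BZ cB.
have /boolp.choice[g gP] : forall W : set X, exists g : X -> R, continuous g /\
    (coZ R X W -> W = [set x | g x != 0%R]).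
  move=> W; have [[g cg ->]|nW] := pselect (coZ R X W); first by exists g.
  by exists (fun=> 0%R); split=> //; exact: cst_continuous.
pose Q := (fun p => [set x | ratr p.2 < (-1) ^+ p.1.2 * g p.1.1 x]%R) @`
    ((B `*` [set: bool]) `*` [set: rat]).
have cQ : countable Q by apply/countable_image/countableX => //; exact: countableX.
have SeqQ : property_Seq Q by exact: rational_cuts_Seq.
have Qo : Q `<=` open.
  move=> _ [[[W b] q] _ <-] /=; apply: (@coZ_open R); apply: coZ_lt.
    exact: cst_continuous.
  by move=> x; apply: cvgM; [exact: cvg_cst|exact: (gP W).1].
have [f fQ] := Seq_quotient R cptX Qo SeqQ.
exists f; split.
  exists (range (fun s : seq (set_type Q) => f @` finite_meet s)).
    by apply: countable_image; exact: countable_seq.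
  exact: meets_basis.
move=> W BW; have [gW WE] := gP W.
have [|h ch gE] := factor_through cptX (@image_hausdorff _ f)
    (@onto_continuous _ f) (@onto_surj _ f) gW.
  move=> x y /fQ xy; apply/eqP; rewrite -subr_eq0; apply: contrapT => /negP gxy.
  wlog gxy0 : x y xy gxy / (g W x < g W y)%R.
    move=> wl; have [xly|ylx|e] := ltgtP (g W x) (g W y).
    + exact: wl gxy xly.
    + apply: (wl y x) ylx; first by move=> V QV; apply: iff_sym; exact: xy.
      by rewrite subr_eq0 eq_sym -subr_eq0.
    + by move: gxy; rewrite e subrr eqxx.
  have [q] := rat_in_itvoo gxy0; rewrite in_itv /= => /andP[xq qy].
  have Qq : Q [set z | ratr q < (-1) ^+ false * g W z]%R by exists (W, false, q).
  have [_] := xy _ Qq; rewrite /= !expr0 !mul1r => /(_ qy) qx.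
  by have := lt_trans xq qx; rewrite ltxx.
exists [set y | h y != 0%R]; first by exists h.
by rewrite (WE (BZ _ BW)) gE.
Qed.

Lemma club_of_lattice (R : realType) (X : topologicalType)
    (Psi : onto_map X -> Prop) :
  infinite_set [set: X] -> compact [set: X] -> hausdorff_space X ->
  multiplicative_lattice Psi -> (forall f, Psi f -> open_map f) ->
  exists2 C : set (set (set X)), d_club R C & additive_club C.
Proof.
move=> infX cptX hX [L1 L2] Pop.
pose C : set (set (set X)) := [set P | [/\ P `<=` coZ R X, countable P & infinite_set P] /\
  [/\ lattice_closed P, property_Seq P & exists2 phi, Psi phi & same_fibers phi P]].
have CP P : C P -> [/\ subset_bang R P, property_Seq P & lattice_closed P].
  move=> [[PZ _ /infinite_setN0 P0] [PL PS [phi Pphi fP]]]; split=> //.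
  by apply: (@open_map_bang R X phi) => //; exact: Pop.
exists C; last first.
  move=> A1 A2 [[AZ1 Ac1 Ai1] [AL1 AS1 [phi1 Pphi1 fA1]]].
  move=> [[AZ2 Ac2 Ai2] [AL2 AS2 [phi2 Pphi2 fA2]]].
  have AZ : A1 `|` A2 `<=` coZ R X by move=> W [/AZ1|/AZ2].
  split; split.
  - exact: gen_lattice_coZ.
  - by apply: gen_lattice_countable AZ _; exact: countableU.
  - by apply: sub_infinite_set Ai1 => W AW; apply: sub_gen_lattice; left.
  - exact: gen_lattice_closed.
  - by apply: gen_lattice_Seq; exact: SeqU.
  have [|psi Ppsi dpsi] := L2 bool (fun b => if b then phi1 else phi2); first by case.
  exists psi => // x y; rewrite (diagonal_fibers _ _ dpsi); split=> [xy|xy [|]].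
  - apply: gen_lattice_fibers => W [AW|AW].
      exact: (fA1 x y).1 (xy true) _ AW.
    exact: (fA2 x y).1 (xy false) _ AW.
  - by apply/fA1 => W AW; apply: xy; apply: sub_gen_lattice; left.
  - by apply/fA2 => W AW; apply: xy; apply: sub_gen_lattice; right.
split=> //; split=> [P [] //|A A1 CA|B BZ cB].
  have fA n : exists phi, Psi phi /\ same_fibers phi (A n).
    by have [_ [_ _ [phi Pphi fAn]]] := CA n; exists phi.
  have [phi phiP] := boolp.choice fA.
  have [|psi Ppsi dpsi] := L2 nat phi; first by move=> n; have [] := phiP n.
  split; split.
  - by move=> W [n _]; have [[AZ _ _] _] := CA n; exact: AZ.
  - by apply: bigcup_countable => // n _; have [[]] := CA n.
  - have [[_ _ infA] _] := CA 0%N.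
    by apply: sub_infinite_set infA => W AW; exists 0%N.
  - by apply: lattice_closed_bigcup => // n; have [_ []] := CA n.
  - by apply: Seq_bigcup => n _; have [_ []] := CA n.
  exists psi => // x y; rewrite (diagonal_fibers _ _ dpsi); split=> [xy W [n _ AW]|xy n].
    exact: ((phiP n).2 x y).1 (xy n) _ AW.
  by apply/(phiP n).2 => W AW; apply: xy; exists n.
have [W0 ZW0] := infinite_setN0 (infinite_coZ (R := R) infX cptX hX).
have [e eZ einj] := (card_le_injP _ _ W0).1
  ((infiniteP _).1 (infinite_coZ (R := R) infX cptX hX)).
(* The sets [e n] make the family infinite, as members of a club must be. *)
pose B1 := B `|` range e.
have B1Z : B1 `<=` coZ R X by move=> W [/BZ//|[n _ <-]]; exact: eZ.
have cB1 : countable B1 by apply: countableU => //; exact: countable_image.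
have infB1 : infinite_set B1.
  apply/infiniteP/(card_le_injP _ _ W0); exists e => // n _; right; by exists n.
have [f [[Bf cBf bBf] fB1]] := second_countable_map cptX B1Z cB1.
have [phi [Pphi [h0 ch0 fE] [Bphi [Df [lBphi lDf wphi]]]]] := L1 f.
(* The least basis [Df] embeds into the countable basis [Bf], so either alternative of [weight_le]
   gives countability. *)
have cBphi : countable Bphi.
  case: wphi => // BD; apply: sub_countable BD _.
  by apply: sub_countable cBf; exact: lDf.2.
have [G [GZ Gsep]] := coZ_separating_points R (onto_tychonoff phi) lBphi.1.
have /boolp.choice[V VP] : forall W, exists U, coZ R (image_space phi) U /\
    (B1 W -> W = phi @^-1` U).
  move=> W; have [/fB1[U ZU WE]|nW] := pselect (B1 W).
    exists (h0 @^-1` U); split; first exact: coZ_preimage.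
    by rewrite WE fE.
  by exists set0; split=> //; exact: coZ_set0.
(* [Q] lives on the image of [phi], so its preimages never split a fiber. The sets [G p] separate
   distinct fibers, and the sets [V W] bring in the members of [B1]. *)
have [||Q [EQ QZ cQ QL QS]] :=
    @countable_Seq_lattice R _ (G @` (Bphi `*` Bphi) `|` V @` B1).
- by move=> _ [[p _ <-]|[W _ <-]]; [exact: GZ|exact: (VP W).1].
- by apply: countableU; apply: countable_image => //; exact: countableX.
have B1P : B1 `<=` [set phi @^-1` U | U in Q].
  move=> W BW; exists (V W); first by apply: EQ; right; exists W.
  by rewrite -(VP W).2.
exists [set phi @^-1` U | U in Q]; last by move=> W BW; apply: B1P; left.
split; split.
- by move=> _ [U QU <-]; apply: coZ_preimage; [exact: onto_continuous|exact: QZ].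
- exact: countable_image.
- exact: sub_infinite_set infB1.
- exact: preimage_lattice_closed.
- exact: preimage_Seq.
exists phi => // x y; split=> [xy _ [U QU <-]|xy]; first by rewrite /preimage /= xy.
apply: contrapT => /Gsep[p Bp [Gx nGy]]; apply: nGy.
have PG : [set phi @^-1` U | U in Q] (phi @^-1` G p).
  by exists (G p) => //; apply: EQ; left; exists p.
exact: (xy _ PG).1 Gx.
Qed.

(** * From clubs to multiplicative lattices *)

Lemma diag_map_continuous (X : topologicalType) (J : Type)
    (phi : J -> onto_map X) : continuous (diag_map phi).
Proof.
move=> x; apply/cvg_sup => a.
by apply: (@continuous_comp_initial _ X _ (fun u => u a) (diag_map phi)) x => x;
  exact: onto_continuous.
Qed.

Lemma diagonal_product_continuous (X : topologicalType) (J : Type)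
    (phi : J -> onto_map X) : continuous (diagonal_product phi).
Proof. by apply: continuous_comp_initial; exact: diag_map_continuous. Qed.

Lemma hausdorff_inj (X Y : topologicalType) (f : X -> Y) :
  continuous f -> injective f -> hausdorff_space Y -> hausdorff_space X.
Proof.
move=> cf finj hY x y xy; apply/finj/hY => U V /cf nU /cf nV.
by have [z [Uz Vz]] := xy _ _ nU nV; exists (f z).
Qed.

Lemma diagonal_product_hausdorff (X : topologicalType) (J : Type)
    (phi : J -> onto_map X) :
  hausdorff_space (set_type (range (diag_map phi))).
Proof.
apply: (@hausdorff_inj _ _ set_val); [exact: initial_continuous|exact: val_inj|].
apply: (@hausdorff_product {classic J} (fun a => image_space (phi a))) => a.
exact: image_hausdorff.
Qed.

(** Each map factors through the other, and surjectivity makes the two factors mutually inverse. *)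
Lemma homeomorphic_same_fibers (X Y Z : topologicalType) (f : X -> Y) (g : X -> Z) :
  compact [set: X] -> hausdorff_space Y -> hausdorff_space Z ->
  continuous f -> continuous g ->
  set_surj [set: X] [set: Y] f -> set_surj [set: X] [set: Z] g ->
  (forall x y, f x = f y <-> g x = g y) -> homeomorphic_maps f g.
Proof.
move=> cptX hY hZ cf cg sf sg fg.
have [|h ch fE] := factor_through cptX hZ cg sg cf; first by move=> x y /fg.
have [|k ck gE] := factor_through cptX hY cf sf cg; first by move=> x y /fg.
exists h => //; exists k; split=> //.
  by move=> z; have [x _ <-] := sg z I; rewrite -[h (g x)]/((h \o g) x) -fE gE.
by move=> y; have [x _ <-] := sf y I; rewrite -[k (f x)]/((k \o f) x) -gE fE.
Qed.

(** * Subfamilies of a club and their unions *)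

Definition sigma_closed (T : Type) (D : set (set (set T))) : Prop :=
  forall A : nat -> set (set T), (forall n, A n `<=` A n.+1) ->
    (forall n, D (A n)) -> D (\bigcup_n A n).

(** Unlike a club, a subclub need not be cofinal: the union of its members may define a coarse
    quotient, and the empty subclub gives a constant map. *)
Definition subclub (T : Type) (C D : set (set (set T))) : Prop :=
  [/\ D `<=` C, additive_club D & sigma_closed D].

Lemma subclub_union_closed (T : Type) (C D : set (set (set T))) :
  subclub C D -> lattice_closed (\bigcup_(P in D) P).
Proof.
move=> [_ Dadd _]; split=> U V [A DA AU] [B DB BV];
  exists (gen_lattice (A `|` B)); try exact: Dadd.
  by apply: (gen_lattice_closed _).1; apply: sub_gen_lattice; [left|right].
by apply: (gen_lattice_closed _).2; apply: sub_gen_lattice; [left|right].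
Qed.

(** Additivity yields the increasing finite joins [E n], and their union stays in [D]. *)
Lemma subclub_sequence (T : Type) (C D : set (set (set T)))
    (A : nat -> set (set T)) : subclub C D -> (forall n, D (A n)) ->
  exists2 P, D P & forall n, A n `<=` P.
Proof.
move=> [_ Dadd Dsig] DA.
pose E := fix E n := if n is m.+1 then gen_lattice (E m `|` A m.+1) else A 0%N.
exists (\bigcup_n E n).
  apply: Dsig => [n W EW|]; first by apply: sub_gen_lattice; left.
  by elim=> [|n IHn] /=; [exact: DA|exact: Dadd].
move=> [|n] W AW; first by exists 0%N.
by exists n.+1 => //=; apply: sub_gen_lattice; right.
Qed.

Lemma countable_sequence (T : Type) (A : set T) (t0 : T) : A t0 -> countable A ->
  exists u : nat -> T, range u = A.
Proof.
move=> At0 /(card_le_injP _ _ 0%N)[e _ einj].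
have /boolp.choice[u uP] : forall n, exists t, A t /\ forall s, A s -> e s = n -> t = s.
  move=> n; have [[t At <-]|nt] := pselect (exists2 t, A t & e t = n).
    by exists t; split=> // s As st; apply: einj; rewrite ?inE.
  by exists t0; split=> // s As sn; exfalso; apply: nt; exists s.
exists u; apply/seteqP; split=> [_ [n _ <-]|t At]; first by have [] := uP n.
by exists (e t) => //; exact: (uP _).2.
Qed.

(* An elementary-submodel argument: were the conclusion to fail, countable
   closing off would give a member [P] of [D] in which it already fails for
   the countable family [S `&` P]. *)
Lemma subclub_bang (R : realType) (X : topologicalType)
    (C D : set (set (set X))) : d_club R C -> subclub C D ->
  forall (S : set (set X)) (x : X), S `<=` \bigcup_(P in D) P ->
    ~ closure (\bigcup_(U in S) U) x ->
    exists W, [/\ (setT |` \bigcup_(P in D) P) W, W x &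
                 W `&` \bigcup_(U in S) U = set0].
Proof.
move=> [[CZ _ _] Cd] DC S x SD xS; have [DsubC _ Dsig] := DC.
have [[P0 DP0]|nD] := pselect (D !=set0); last first.
  exists setT; split=> //; first by left.
  rewrite -subset0 => y [_ [U /SD[P DP _]]].
  by exfalso; apply: nD; exists P.
apply: contrapT => nW.
(* If the conclusion fails, every [W] around [x] in the union of [D] meets some member of [S]; [s W]
   records it with a member of [D] containing it. Elsewhere the value is a default. *)
have /boolp.choice[s sP] : forall W, exists VA : set X * set (set X), D VA.2 /\
    ((\bigcup_(P in D) P) W -> W x -> [/\ S VA.1, VA.2 VA.1 & W `&` VA.1 !=set0]).
  move=> W; have [[DW Wx]|nDW] := pselect ((\bigcup_(P in D) P) W /\ W x).
    have [y [Wy [U SU Uy]]] : W `&` \bigcup_(U in S) U !=set0.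
      apply/set0P/eqP => WS; apply: nW; exists W; split=> //; by right.
    have [A DA AU] := SD _ SU; exists (U, A); split=> // _ _; split=> //.
    by exists y.
  by exists (set0, P0); split=> // DW Wx; exfalso; apply: nDW.
have /boolp.choice[step stepP] : forall P, exists P', D P -> [/\ D P', P `<=` P' &
    forall W, P W -> (s W).2 `<=` P'].
  move=> P; have [DP|nDP] := pselect (D P); last by exists P.
  have [_ cP infP] := CZ _ (DsubC _ DP).
  have [W0 PW0] := infinite_setN0 infP.
  have [u uP] := countable_sequence PW0 cP.
  have [|P' DP' AP'] := @subclub_sequence _ _ _
    (fun n => if n is m.+1 then (s (u m)).2 else P) DC.
    by move=> [|m] //; have [] := sP (u m).
  exists P' => _; split=> //; first exact: (AP' 0%N).
  by move=> W; rewrite -uP => -[n _ <-]; exact: (AP' n.+1).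
pose A n := iter n step P0.
have DA n : D (A n) by elim: n => //= n IHn; have [] := stepP _ IHn.
have A1 n : A n `<=` A n.+1 by have [] := stepP _ (DA n).
pose P := \bigcup_n A n.
have DP : D P by exact: Dsig.
have [[_ bangP] _ _] := Cd _ (DsubC _ DP).
have [||W [PW Wx WS]] := bangP (S `&` P) x.
- by move=> U [].
- move=> clx; apply: xS => B /clx[y [[U [SU _] Uy] By]]; exists y.
  by split=> //; exists U.
(* A set [W] of stage [n] has its recorded witness in stage [n.+1], hence in [P], although [W] was
   to miss all of [S] inside [P]. *)
have [n _ AW] := PW.
have [|//|SsW sW [y [Wy sy]]] := (sP W).2; first by exists P.
have : (W `&` \bigcup_(U in S `&` P) U) y.
  split=> //; exists (s W).1 => //; split=> //; exists n.+1 => //.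
  by have [_ _ ] := stepP _ (DA n); apply; [exact: AW|].
by rewrite WS.
Qed.

Definition generated_subclub (T : Type) (D0 : set (set (set T))) :=
  smallest (fun D => additive_club D /\ sigma_closed D) D0.

Lemma generated_subclub_min (T : Type) (D0 D : set (set (set T))) :
  additive_club D -> sigma_closed D -> D0 `<=` D -> generated_subclub D0 `<=` D.
Proof. by move=> Dadd Dsig; exact: smallest_sub. Qed.

Lemma sub_generated_subclub (T : Type) (D0 : set (set (set T))) :
  D0 `<=` generated_subclub D0.
Proof. exact: sub_gen_smallest. Qed.

Lemma generated_subclubP (T : Type) (C D0 : set (set (set T))) :
  additive_club C -> sigma_closed C -> D0 `<=` C ->
  subclub C (generated_subclub D0).
Proof.
move=> Cadd Csig D0C; split; first exact: generated_subclub_min.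
  move=> A B DA DB M MD; have [[Madd _] _] := MD.
  exact: Madd (DA _ MD) (DB _ MD).
move=> A A1 DA M MD; have [[_ Msig] _] := MD.
by apply: Msig => // n; exact: DA.
Qed.

(** Closing off adds many sets but separates no new points, so the quotient, and with it the weight,
    can be computed from [D0] alone. *)
Lemma generated_subclub_fibers (T : Type) (D0 : set (set (set T))) (x y : T) :
  (forall P, D0 P -> forall W, P W -> (W x <-> W y)) ->
  forall W, (\bigcup_(P in generated_subclub D0) P) W -> (W x <-> W y).
Proof.
move=> D0xy W [P DP PW].
suff : generated_subclub D0 `<=` [set P | forall W, P W -> (W x <-> W y)].
  by move=> /(_ P DP W PW).
apply: generated_subclub_min => //.
  move=> A B /= Axy Bxy; apply: gen_lattice_fibers => V [AV|BV]; [exact: Axy|exact: Bxy].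
by move=> A A1 Axy V [n _ AV]; exact: Axy AV.
Qed.

(** A set in the union is coded by a word over [B], a word of such sets by a word of words, and
    [seq_inj_infinite] collapses both levels. *)
Lemma card_seq_bigcup (T U : Type) (B : set T) (A : T * T -> set U) :
  infinite_set B -> (forall p, countable (A p)) ->
  [set: seq (set_type (\bigcup_(p in B `*` B) A p))] #<= B.
Proof.
move=> infB cA; have [t0 _] := infinite_setN0 infB.
pose K := {classic (set_type B)}.
have infK : infinite_set [set: K].
  move=> finK; apply: infB; have -> : B = (fun k : K => val (k : set_type B)) @` setT.
    by apply/seteqP; split=> [t Bt|_ [k _ <-]];
      [exists (exist _ t (mem_set Bt))|exact: set_valP].
  exact: finite_image.
have [F Finj] := seq_inj_infinite infK.
have /boolp.choice[e eP] : forall p, exists e : U -> nat, set_inj (A p) e.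
  by move=> p; have [e _ einj] := (card_le_injP _ _ 0%N).1 (cA p); exists e.
set E := \bigcup_(p in B `*` B) A p.
have /boolp.choice[c cP] : forall w : set_type E, exists q : K * K,
    A (val (q.1 : set_type B), val (q.2 : set_type B)) (val w).
  move=> w; have [[a b] [/= Ba Bb] Aw] := set_valP w.
  by exists (exist _ a (mem_set Ba), exist _ b (mem_set Bb)).
(* The first two letters name the pair [p]; the rest writes the number of [w] within [A p] in
   unary. *)
pose code w : seq K := [:: (c w).1, (c w).2 &
  nseq (e (val ((c w).1 : set_type B), val ((c w).2 : set_type B)) (val w)) (c w).1].
have code_inj : injective code.
  move=> w v [ca cb /(congr1 size)]; rewrite !size_nseq.
  have cvE : c v = c w by rewrite [LHS]surjective_pairing -ca -cb -surjective_pairing.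
  rewrite cvE => wv; apply: val_inj; apply: eP wv; rewrite inE; first exact: cP.
  by rewrite -cvE; exact: cP.
apply/(card_le_injP _ _ t0).
exists (fun s => val (F (map (F \o code) s) : set_type B)).
  by move=> s _; exact: set_valP.
by move=> s r _ _ /val_inj/Finj/inj_map; apply => w v /Finj/code_inj.
Qed.

Lemma lattice_of_club (R : realType) (X : topologicalType)
    (C : set (set (set X))) :
  compact [set: X] -> hausdorff_space X -> d_club R C -> additive_club C ->
  exists2 Psi : onto_map X -> Prop,
    multiplicative_lattice Psi & forall f, Psi f -> open_map f.
Proof.
move=> cptX hX dC Cadd; have [[CZ Csig Ccof] CP] := dC.
have CunionZ D : D `<=` C -> \bigcup_(P in D) P `<=` coZ R X.
  by move=> DC W [P /DC/CZ[PZ _ _] PW]; exact: PZ.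
have CunionO D : D `<=` C -> \bigcup_(P in D) P `<=` open.
  by move=> DC W /(CunionZ _ DC)/coZ_open.
have CunionSeq D : D `<=` C -> property_Seq (\bigcup_(P in D) P).
  by move=> DC; apply: Seq_bigcup => P /DC/CP[].
exists (fun f : onto_map X => exists2 D, subclub C D &
  same_fibers f (\bigcup_(P in D) P)); last first.
  move=> f [D DC fD]; have [DsubC _ _] := DC.
  apply: (bang_open_map cptX hX _ _ _ fD); [exact: CunionO| |exact: CunionSeq|].
    by have [] := subclub_union_closed DC.
  exact: subclub_bang dC DC.
split=> [f|J phi Pphi].
  have [Bf lBf] := least_basis_exists (image_space f).
  have [G [GZ Gsep]] := coZ_separating_points R (onto_tychonoff f) lBf.1.
  have /boolp.choice[A AP] : forall p, exists P, C P /\ P (f @^-1` G p).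
    move=> p; have [||P CP' GP] := Ccof [set f @^-1` G p].
    - by move=> _ ->; apply: coZ_preimage => //; exact: onto_continuous.
    - exact: countable1.
    by exists P; split=> //; exact: GP.
  pose D0 := A @` (Bf `*` Bf).
  have D0C : D0 `<=` C by move=> _ [p _ <-]; have [] := AP p.
  have DC := generated_subclubP Cadd Csig D0C.
  set D := generated_subclub D0 in DC; have [DsubC _ _] := DC.
  have [phi phiD] := Seq_quotient R cptX (CunionO _ DsubC) (CunionSeq _ DsubC).
  (* [E] has the same fibers as the union of [D], but consists of countable families indexed by
     pairs of basic sets, and so controls the weight. *)
  pose E := \bigcup_(p in Bf `*` Bf) A p.
  have phiE : same_fibers phi E.
    move=> x y; rewrite phiD; split=> [xy W [p Bp AW]|xy].
      by apply: xy; exists (A p) => //; apply: sub_generated_subclub; exists p.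
    by apply: generated_subclub_fibers => _ [p Bp <-] W AW; apply: xy; exists p.
  exists phi; split; first by exists D.
    have [|h ch fE] := factor_through cptX (@image_hausdorff _ phi)
      (@onto_continuous _ phi) (@onto_surj _ phi) (@onto_continuous _ f).
      move=> x y /phiE xy; apply: contrapT => /Gsep[p Bp [Gx nGy]]; apply: nGy.
      have EG : E (f @^-1` G p) by exists p => //; have [] := AP p.
      exact: (xy _ EG).1 Gx.
    by exists h.
  have [Bphi lBphi] := least_basis_exists (image_space phi).
  have Eo : E `<=` open.
    move=> W [p _ AW]; have [CA _] := AP p; have [AZ _ _] := CZ _ CA.
    exact: coZ_open (AZ _ AW).
  have SeqE : property_Seq E.
    by apply: Seq_bigcup => p _; have [CA _] := AP p; have [] := CP _ CA.
  have cA p : countable (A p) by have [CA _] := AP p; have [] := CZ _ CA.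
  have Bphi_le : Bphi #<= [set: seq (set_type E)].
    apply: card_le_trans (lBphi.2 _ (meets_basis cptX Eo SeqE phiE)) _.
    exact: card_image_le.
  exists Bphi, Bf; split=> //.
  (* Counting words over [E] by [Bf] requires [Bf] to be infinite; a countable [Bf] leads to the
     first alternative of [weight_le]. *)
  have [cBf|ncBf] := pselect (countable Bf).
    left; apply: sub_countable Bphi_le _; apply: countable_seq.
    by apply: bigcup_countable => //; exact: countableX.
  right; apply: card_le_trans Bphi_le _; apply: card_seq_bigcup => //.
  by move=> /finite_set_countable.
(* The subclubs of all the maps [phi a] are merged before closing off; the result separates two
   points exactly when some [phi a] does. *)
pose D0 := [set P | exists a D, [/\ subclub C D,
  same_fibers (phi a) (\bigcup_(Q in D) Q) & D P]].
have D0C : D0 `<=` C by move=> P [a [D [[DC _ _] _ DP]]]; exact: DC.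
have DC := generated_subclubP Cadd Csig D0C.
set D := generated_subclub D0 in DC; have [DsubC _ _] := DC.
have [psi psiD] := Seq_quotient R cptX (CunionO _ DsubC) (CunionSeq _ DsubC).
exists psi; first by exists D.
apply: homeomorphic_same_fibers => //.
- exact: diagonal_product_hausdorff.
- exact: image_hausdorff.
- exact: diagonal_product_continuous.
- exact: onto_continuous.
- by move=> u _; have [x _ xu] := set_valP u; exists x => //; exact: val_inj.
- exact: onto_surj.
move=> x y; rewrite psiD; split=> [/(congr1 val)/= xy|xy].
  apply: generated_subclub_fibers => P [a [D' [D'C phiD' D'P]]] W PW.
  have phixy : phi a x = phi a y by exact: (congr1 (fun u => u a) xy).
  by apply: (phiD' x y).1 phixy _ _; exists P.
apply: val_inj => /=; apply: functional_extensionality_dep => a.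
have [D' D'C phiD'] := Pphi a.
apply/phiD' => W [P D'P PW]; apply: xy; exists P => //.
by apply: sub_generated_subclub; exists a, D'; split.
Qed.

Theorem corollary15 (R : realType) (X : topologicalType)
    (infX : infinite_set [set: X]) (cptX : compact [set: X])
    (hausX : hausdorff_space X) :
  dugundji_space X <->
  exists2 C : set (set (set X)), d_club R C & additive_club C.
Proof.
split=> [[_ _ [Psi PsiL Psio]]|[C dC Cadd]]; first exact: club_of_lattice PsiL Psio.
by split=> //; exact: lattice_of_club dC Cadd.
Qed.
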